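(* Let $G$ and $H$ be connected graphs with the same number $n$ of vertices, and let $k\ge 1$ be an integer. Then the Cartesian product $G\,\square\, H$ is an $(nk)$-STI graph if and only if both $G$ and $H$ are $k$-STI graphs.
   Context: All graphs are finite, simple and connected. The transmission of a vertex $u$ is $\mathrm{Tr}_G(u)=\sum_{x\in V(G)} d_G(u,x)$, where $d_G$ is the shortest-path distance. For an integer $m\ge 1$, $G$ is an $m$-STI graph if $|\mathrm{Tr}_G(u)-\mathrm{Tr}_G(v)|=m$ for every edge $uv\in E(G)$. The Cartesian product $G\,\square\, H$ has vertex set $V(G)\times V(H)$, with $(u,v)$ and $(x,y)$ adjacent if either $u=x$ and $vy\in E(H)$, or $v=y$ and $ux\in E(G)$. *)

(* Defs.v *)
From mathcomp Require Import all_boot all_order all_algebra.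

Set Implicit Arguments.
Unset Strict Implicit.
Unset Printing Implicit Defensive.

Record sgraph := SGraph {
  vertex :> finType;
  edge : rel vertex;
  edge_sym : symmetric edge;
  edge_irr : irreflexive edge
}.

(* A connected graph has at least one vertex. *)
Definition connected_graph (G : sgraph) : Prop :=
  0 < #|G| /\ forall u v : G, connect (@edge G) u v.

(* [u :: p] is a path (without repeated vertices) from [u] to [v], and it has
   [k] edges. *)
Definition has_path (G : sgraph) (u v : G) (k : nat) : bool :=
  [exists p : k.-tuple G,
     [&& path (@edge G) u p, last u p == v & uniq (u :: p)]].

(* The least length of a path from [u] to [v]: a path has fewer than [#|G|]
   edges, so every possible length occurs in [iota 0 #|G|], where positions and
   values coincide.  The value is [#|G|] if there is no such path. *)
Definition dist (G : sgraph) (u v : G) : nat :=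
  find (has_path u v) (iota 0 #|G|).

Definition transmission (G : sgraph) (u : G) : nat := \sum_(x : G) dist u x.

Definition STI (m : nat) (G : sgraph) : Prop :=
  connected_graph G /\
  forall u v : G, edge u v ->
    `|(Posz (transmission u) - Posz (transmission v))%R|%N = m.

Section CartesianProduct.
Variables G H : sgraph.

Definition cart_edge : rel (G * H) := fun a b =>
  (a.1 == b.1) && edge a.2 b.2 || (a.2 == b.2) && edge a.1 b.1.

Lemma cart_edge_sym : symmetric cart_edge.
Proof.
by move=> a b; rewrite /cart_edge (eq_sym a.1) (eq_sym a.2)
  (edge_sym a.1) (edge_sym a.2).
Qed.

Lemma cart_edge_irr : irreflexive cart_edge.
Proof. by move=> a; rewrite /cart_edge !edge_irr !andbF. Qed.

Definition cart_prod : sgraph := SGraph cart_edge_sym cart_edge_irr.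

End CartesianProduct.

Lemma has_path_bound (G : sgraph) (u v : G) k : has_path u v k -> k < #|G|.
Proof.
case/existsP=> p /and3P[_ _ up].
by rewrite -[k](size_tuple p) -[_.+1]/(size (u :: p)) -(card_uniqP up) max_card.
Qed.

Lemma dist_le (G : sgraph) (u v : G) p :
  path (@edge G) u p -> last u p = v -> dist u v <= size p.
Proof.
move=> pp <-; case: (shortenP pp) => q pq uq qp.
apply: (@leq_trans (size q)); last first.
  by apply: uniq_leq_size => //; case/andP: uq.
have hq : has_path u (last u q) (size q).
  by apply/existsP; exists (in_tuple q); rewrite /= pq eqxx.
rewrite leqNgt; apply/negP => lt_q.
by have := before_find 0 lt_q; rewrite nth_iota ?(has_path_bound hq) // hq.
Qed.

Lemma dist_path (G : sgraph) (u v : G) :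
  connect (@edge G) u v -> has_path u v (dist u v).
Proof.
case/connectP=> p pp ->; case: (shortenP pp) => q pq uq _.
have hq : has_path u (last u q) (size q).
  by apply/existsP; exists (in_tuple q); rewrite /= pq eqxx.
have hs : has (has_path u (last u q)) (iota 0 #|G|).
  by apply/hasP; exists (size q); rewrite // mem_iota (has_path_bound hq).
have := nth_find 0 hs; rewrite nth_iota ?add0n //.
by rewrite -[X in _ < X](size_iota 0) -has_find.
Qed.

(* Main.v *)
Require Import Defs.
From mathcomp Require Import all_boot all_order all_algebra.
From mathcomp Require Import zify.

(** Distances in a Cartesian product add up coordinatewise, so the
    transmission of [(u, v)] is [|H| Tr_G(u) + |G| Tr_H(v)].  Along an edge of
    the product only one coordinate changes, hence when [|G| = |H| = n] the
    transmission difference along it is [n] times the difference along an edge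
    of [G] or of [H], and every edge of either factor arises in this way. *)

Lemma geodesic (G : sgraph) (u v : G) :
  connect (@edge G) u v ->
  exists p, [/\ path (@edge G) u p, last u p = v & size p = dist u v].
Proof.
move=> /dist_path /existsP[p /and3P[pp /eqP lp _]].
by exists p; rewrite size_tuple.
Qed.

Lemma dist_refl (G : sgraph) (u : G) : dist u u = 0.
Proof. by apply/eqP; rewrite -leqn0 (@dist_le G u u [::]). Qed.

(** Prepend [u] to a geodesic from [w] to [v]. *)
Lemma dist_edge (G : sgraph) (u w v : G) :
  connect (@edge G) w v -> edge u w -> dist u v <= (dist w v).+1.
Proof.
case/geodesic=> p [pp lp <-] uw.
by apply: (@dist_le G u v (w :: p)); rewrite //= uw.
Qed.

Section CartesianDistance.
Variables G H : sgraph.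
Hypotheses (hG : connected_graph G) (hH : connected_graph H).

Lemma cart_path_fst (v : H) (u : G) p : path (@edge G) u p ->
  path (@cart_edge G H) (u, v) [seq (x, v) | x <- p].
Proof.
by elim: p u => //= w p IHp u /andP[uw /IHp->]; rewrite /cart_edge /= eqxx uw orbT.
Qed.

Lemma cart_path_snd (u : G) (v : H) p : path (@edge H) v p ->
  path (@cart_edge G H) (u, v) [seq (u, y) | y <- p].
Proof.
by elim: p v => //= w p IHp v /andP[vw /IHp->]; rewrite /cart_edge /= eqxx vw.
Qed.

(** A geodesic of [G] is followed in the layer over [v], then a geodesic of [H] in the layer over
    [x]. This yields both connectedness of the product and the upper bound on its distances. *)
Lemma cart_geodesic (a b : G * H) : exists p,
  [/\ path (@cart_edge G H) a p, last a p = b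
    & size p = dist a.1 b.1 + dist a.2 b.2].
Proof.
case: a b => [u v] [x y] /=.
have [p [pp lp sp]] := geodesic _ _ _ (hG.2 u x).
have [q [pq lq sq]] := geodesic _ _ _ (hH.2 v y).
exists ([seq (z, v) | z <- p] ++ [seq (x, z) | z <- q]).
have lpv : last (u, v) [seq (z, v) | z <- p] = (x, v).
  by rewrite (last_map (fun z => (z, v))) lp.
rewrite cat_path last_cat size_cat !size_map lpv sp sq cart_path_fst //.
by rewrite cart_path_snd // (last_map (fun z => (x, z))) lq.
Qed.

Lemma connected_cart_prod : connected_graph (cart_prod G H).
Proof.
split=> [|a b]; first by rewrite card_prod muln_gt0 hG.1 hH.1.
by have [p [pp <- _]] := cart_geodesic a b; apply/connectP; exists p.
Qed.

Lemma dist_cart_prod (a b : cart_prod G H) :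
  dist a b = dist a.1 b.1 + dist a.2 b.2.
Proof.
apply/eqP; rewrite eqn_leq; apply/andP; split.
  have [p [pp lp <-]] := cart_geodesic a b.
  exact: (@dist_le (cart_prod G H) a b p pp lp).
have [p [pp lp <-]] := geodesic _ _ _ (connected_cart_prod.2 a b).
(* Lower bound, for any walk [p] to [b]: each step keeps one coordinate and moves the other along an
   edge, so the sum of the two distances to [b] drops by at most one. *)
elim: p a pp lp => [|c p IHp] a /=; first by move=> _ ->; rewrite !dist_refl.
case/andP=> ac pp lp; apply: leq_trans (IHp c pp lp : _ < (size p).+1).
case/orP: ac => /andP[/eqP-> e].
  by rewrite -addnS leq_add2l dist_edge // hH.2.
by rewrite -addSn leq_add2r dist_edge // hG.2.
Qed.

(** Over all pairs [(x, y)], each [dist u x] is counted once per vertex of [H], and each [dist v y]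
    once per vertex of [G]. *)
Lemma transmission_cart_prod (u : G) (v : H) :
  @transmission (cart_prod G H) (u, v) =
    #|H| * transmission u + #|G| * transmission v.
Proof.
rewrite /transmission (eq_bigr _ (fun b _ => dist_cart_prod (u, v) b)) /=.
rewrite big_split /=; congr (_ + _).
  rewrite -(pair_big predT predT (fun x (_ : H) => dist u x)) /=.
  by rewrite big_distrr; apply: eq_bigr => x _; rewrite sum_nat_const.
rewrite -(pair_big predT predT (fun (_ : G) y => dist v y)) /=.
by rewrite sum_nat_const.
Qed.

End CartesianDistance.

(** Here [c] stands for the contribution of the coordinate that an edge leaves fixed. *)
Lemma absz_sub_scaled (n c s t : nat) :
  `|(Posz (n * s + c) - Posz (n * t + c))%R|%N =
    n * `|(Posz s - Posz t)%R|%N.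
Proof. nia. Qed.

Theorem theorem3p1 (G H : sgraph) (n k : nat)
  (hG : connected_graph G) (hH : connected_graph H)
  (nG : #|G| = n) (nH : #|H| = n) (hk : 1 <= k) :
  STI (n * k) (cart_prod G H) <-> STI k G /\ STI k H.
Proof.
have n_gt0 : 0 < n by rewrite -nG hG.1.
have TrE := transmission_cart_prod _ _ hG hH; rewrite nG nH in TrE.
have fstE u u' v : `|(Posz (@transmission (cart_prod G H) (u, v)) -
    Posz (@transmission (cart_prod G H) (u', v)))%R|%N =
    n * `|(Posz (transmission u) - Posz (transmission u'))%R|%N.
  by rewrite !TrE absz_sub_scaled.
have sndE u v v' : `|(Posz (@transmission (cart_prod G H) (u, v)) -
    Posz (@transmission (cart_prod G H) (u, v')))%R|%N =
    n * `|(Posz (transmission v) - Posz (transmission v'))%R|%N.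
  by rewrite !TrE ![n * transmission u + _]addnC absz_sub_scaled.
split=> [[_ stiGH] | [[_ stiG] [_ stiH]]].
  (* Base vertices: an edge of [G] is lifted to the layer over [y0], an edge of [H] to the layer
     over [x0]; the factor [n] then cancels. *)
  have [x0 _] := card_gt0P hG.1; have [y0 _] := card_gt0P hH.1.
  split; split=> // u v uv; apply/eqP; rewrite -(eqn_pmul2l n_gt0); apply/eqP.
    by rewrite -(fstE u v y0) stiGH //= /cart_edge /= eqxx uv orbT.
  by rewrite -(sndE x0 u v) stiGH //= /cart_edge /= eqxx uv.
(* Product edges are split by the coordinate they fix: first the [G] one, then the [H] one. *)
split=> [|[u v] [u' v'] /orP[] /andP[/= /eqP<- e]].
- exact: connected_cart_prod.
- by rewrite sndE stiH.
- by rewrite fstE stiG.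
Qed.
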